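(* Let $h>0$ and let $\mathbb{A}$ be either the algebra of octonions $\mathbb{O}$ or the algebra of split-octonions $\mathbb{O}'$, with basis $\mathbf{e}_0,\ldots,\mathbf{e}_7$. Put $(K_1,\ldots,K_7)=(I_1,\ldots,I_7)$ if $\mathbb{A}=\mathbb{O}$, and $(K_1,\ldots,K_7)=(J_1,\ldots,J_7)$ if $\mathbb{A}=\mathbb{O}'$, where $I_s,J_s\subset\{1,\ldots,7\}$ are the index sets listed in the context. Then for all discrete functions $f,g\colon h\mathbb{Z}^8\to\mathbb{A}$, $f=\sum_{k=0}^7 f_k\mathbf{e}_k$, $g=\sum_{i=0}^7 g_i\mathbf{e}_i$, such that the series converge (in the sense specified in the context), the discrete Stokes' formula holds on the whole lattice: $$\sum_{m\in\mathbb{Z}^8}\Big[\big(g(mh)D_h^{+}\big)f(mh)+g(mh)\big(D_h^{-}f(mh)\big)\Big]h^8 = 2\sum_{m\in\mathbb{Z}^8}\sum_{s=1}^{7}\ \sum_{i\in K_s}\ \sum_{\substack{j\in K_s\\ j\neq i}}\ \sum_{\substack{1\le k\le 7\\ k\notin K_s}} g_i(mh)\,\big(\partial_h^{-j}f_k(mh)\big)\,\mathbf{e}_i\big(\mathbf{e}_j\mathbf{e}_k\big)\,h^8 .$$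
   Context: Algebras. $\mathbb{O}$ and $\mathbb{O}'$ are the 8-dimensional real non-associative algebras with basis $\mathbf{e}_0=1$ (unit), $\mathbf{e}_1,\ldots,\mathbf{e}_7$, with bilinear multiplication satisfying $\mathbf{e}_j\mathbf{e}_i=-\mathbf{e}_i\mathbf{e}_j$ for distinct $i,j\in\{1,\ldots,7\}$, and given by the following rules. Octonions $\mathbb{O}$: $\mathbf{e}_i^2=-1$ for $i=1,\ldots,7$, and $\mathbf{e}_1\mathbf{e}_2=\mathbf{e}_4$, $\mathbf{e}_1\mathbf{e}_3=\mathbf{e}_5$, $\mathbf{e}_1\mathbf{e}_4=-\mathbf{e}_2$, $\mathbf{e}_1\mathbf{e}_5=-\mathbf{e}_3$, $\mathbf{e}_1\mathbf{e}_6=-\mathbf{e}_7$, $\mathbf{e}_1\mathbf{e}_7=\mathbf{e}_6$, $\mathbf{e}_2\mathbf{e}_3=\mathbf{e}_6$, $\mathbf{e}_2\mathbf{e}_4=\mathbf{e}_1$, $\mathbf{e}_2\mathbf{e}_5=\mathbf{e}_7$, $\mathbf{e}_2\mathbf{e}_6=-\mathbf{e}_3$, $\mathbf{e}_2\mathbf{e}_7=-\mathbf{e}_5$, $\mathbf{e}_3\mathbf{e}_4=-\mathbf{e}_7$, $\mathbf{e}_3\mathbf{e}_5=\mathbf{e}_1$, $\mathbf{e}_3\mathbf{e}_6=\mathbf{e}_2$, $\mathbf{e}_3\mathbf{e}_7=\mathbf{e}_4$, $\mathbf{e}_4\mathbf{e}_5=-\mathbf{e}_6$, $\mathbf{e}_4\mathbf{e}_6=\mathbf{e}_5$,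 $\mathbf{e}_4\mathbf{e}_7=-\mathbf{e}_3$, $\mathbf{e}_5\mathbf{e}_6=-\mathbf{e}_4$, $\mathbf{e}_5\mathbf{e}_7=\mathbf{e}_2$, $\mathbf{e}_6\mathbf{e}_7=-\mathbf{e}_1$. Split-octonions $\mathbb{O}'$: $\mathbf{e}_1^2=\mathbf{e}_2^2=\mathbf{e}_3^2=-1$, $\mathbf{e}_4^2=\mathbf{e}_5^2=\mathbf{e}_6^2=\mathbf{e}_7^2=1$, and $\mathbf{e}_1\mathbf{e}_2=\mathbf{e}_3$, $\mathbf{e}_1\mathbf{e}_3=-\mathbf{e}_2$, $\mathbf{e}_1\mathbf{e}_4=-\mathbf{e}_5$, $\mathbf{e}_1\mathbf{e}_5=\mathbf{e}_4$, $\mathbf{e}_1\mathbf{e}_6=-\mathbf{e}_7$, $\mathbf{e}_1\mathbf{e}_7=\mathbf{e}_6$, $\mathbf{e}_2\mathbf{e}_3=\mathbf{e}_1$, $\mathbf{e}_2\mathbf{e}_4=-\mathbf{e}_6$, $\mathbf{e}_2\mathbf{e}_5=\mathbf{e}_7$, $\mathbf{e}_2\mathbf{e}_6=\mathbf{e}_4$, $\mathbf{e}_2\mathbf{e}_7=-\mathbf{e}_5$, $\mathbf{e}_3\mathbf{e}_4=-\mathbf{e}_7$, $\mathbf{e}_3\mathbf{e}_5=-\mathbf{e}_6$, $\mathbf{e}_3\mathbf{e}_6=\mathbf{e}_5$, $\mathbf{e}_3\mathbf{e}_7=\mathbf{e}_4$, $\mathbf{e}_4\mathbf{e}_5=\mathbf{e}_1$,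 $\mathbf{e}_4\mathbf{e}_6=\mathbf{e}_2$, $\mathbf{e}_4\mathbf{e}_7=\mathbf{e}_3$, $\mathbf{e}_5\mathbf{e}_6=\mathbf{e}_3$, $\mathbf{e}_5\mathbf{e}_7=-\mathbf{e}_2$, $\mathbf{e}_6\mathbf{e}_7=\mathbf{e}_1$. Index sets. For $\mathbb{O}$: $I_1=\{1,2,4\}$, $I_2=\{1,3,5\}$, $I_3=\{1,6,7\}$, $I_4=\{2,3,6\}$, $I_5=\{2,5,7\}$, $I_6=\{3,4,7\}$, $I_7=\{4,5,6\}$. For $\mathbb{O}'$: $J_1=\{1,2,3\}$, $J_2=\{1,4,5\}$, $J_3=\{1,6,7\}$, $J_4=\{2,4,6\}$, $J_5=\{2,5,7\}$, $J_6=\{3,4,7\}$, $J_7=\{3,5,6\}$. Lattice and operators. $h\mathbb{Z}^8=\{(m_0h,\ldots,m_7h): m_j\in\mathbb{Z}\}$, and $mh$ abbreviates $(m_0h,\ldots,m_7h)$. The components $f_k,g_i$ are real-valued. For a function $u$ on $h\mathbb{Z}^8$ and $j=0,\ldots,7$, $$\partial_h^{+j}u(mh)=h^{-1}\big(u(mh+\mathbf{e}_jh)-u(mh)\big),\qquad \partial_h^{-j}u(mh)=h^{-1}\big(u(mh)-u(mh-\mathbf{e}_jh)\big),$$ where in the argument $\mathbf{e}_j$ is the $j$-th standard unit vector of $\mathbb{R}^8$. The discrete forward and backward Cauchy-Riemann operators are $D_h^{\pm}=\sum_{j=0}^7\mathbf{e}_j\partial_h^{\pm j}$. Acting from the left,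 $D_h^{-}f=\sum_{j=0}^7\mathbf{e}_j(\partial_h^{-j}f)$; acting from the right, $gD_h^{+}=\sum_{j=0}^7(\partial_h^{+j}g)\mathbf{e}_j$. Convergence. ''The series converge'' means that all real series $\sum_{m\in\mathbb{Z}^8}(\partial_h^{+j}g_i)(mh)\,f_k(mh)$ and $\sum_{m\in\mathbb{Z}^8}g_i(mh)\,(\partial_h^{-j}f_k)(mh)$, $i,j,k\in\{0,\ldots,7\}$, converge as unordered series over $\mathbb{Z}^8$ (i.e. absolutely). *)

(* Defs.v *)
From HB Require Import structures.
From mathcomp Require Import all_boot all_order all_algebra.
From mathcomp Require Import all_classical all_reals all_analysis.

Set Implicit Arguments.
Unset Strict Implicit.
Unset Printing Implicit Defensive.

Import Order.TTheory GRing.Theory Num.Theory.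
Import numFieldNormedType.Exports.
Local Open Scope ring_scope.

(* Both algebras, as well as the space
   R^8 containing the lattice, are carried by 'rV[R]_8. *)

Inductive octo_algebra : Set := Octonions | SplitOctonions.

Definition e {R : realType} (k : 'I_8) : 'rV[R]_8 := delta_mx 0 k.

Section Multiplication.
Variable R : realType.

Local Notation E k := (@e R (inord k)).

(* Products of basis elements with indices 1 <= i < j <= 7; NE stands for -E. *)
Local Notation NE k := (- E k).
Local Open Scope nat_scope.

Definition octonion_table (i j : nat) : 'rV[R]_8 :=
  match i, j with
  | 1, 2 => E 4 | 1, 3 => E 5 | 1, 4 => NE 2 | 1, 5 => NE 3
  | 1, 6 => NE 7 | 1, 7 => E 6
  | 2, 3 => E 6 | 2, 4 => E 1 | 2, 5 => E 7 | 2, 6 => NE 3 | 2, 7 => NE 5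
  | 3, 4 => NE 7 | 3, 5 => E 1 | 3, 6 => E 2 | 3, 7 => E 4
  | 4, 5 => NE 6 | 4, 6 => E 5 | 4, 7 => NE 3
  | 5, 6 => NE 4 | 5, 7 => E 2
  | 6, 7 => NE 1
  | _, _ => 0%R
  end.

Definition split_octonion_table (i j : nat) : 'rV[R]_8 :=
  match i, j with
  | 1, 2 => E 3 | 1, 3 => NE 2 | 1, 4 => NE 5 | 1, 5 => E 4
  | 1, 6 => NE 7 | 1, 7 => E 6
  | 2, 3 => E 1 | 2, 4 => NE 6 | 2, 5 => E 7 | 2, 6 => E 4 | 2, 7 => NE 5
  | 3, 4 => NE 7 | 3, 5 => NE 6 | 3, 6 => E 5 | 3, 7 => E 4
  | 4, 5 => E 1 | 4, 6 => E 2 | 4, 7 => E 3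
  | 5, 6 => E 3 | 5, 7 => NE 2
  | 6, 7 => E 1
  | _, _ => 0%R
  end.

Local Close Scope nat_scope.

Definition basis_table (A : octo_algebra) : nat -> nat -> 'rV[R]_8 :=
  match A with
  | Octonions => octonion_table
  | SplitOctonions => split_octonion_table
  end.

(* The square of the i-th basis element, for 1 <= i <= 7. *)
Definition basis_square (A : octo_algebra) (i : nat) : 'rV[R]_8 :=
  match A with
  | Octonions => - E 0
  | SplitOctonions => if (i <= 3)%N then - E 0 else E 0
  end.

Definition basis_mul (A : octo_algebra) (i j : 'I_8) : 'rV[R]_8 :=
  if i == ord0 then e j
  else if j == ord0 then e i
  else if i == j then basis_square A i
  else if (i < j)%N then basis_table A i j
  else - basis_table A j i.

Definition omul (A : octo_algebra) (x y : 'rV[R]_8) : 'rV[R]_8 :=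
  \sum_(i < 8) \sum_(j < 8) (x 0 i * y 0 j) *: basis_mul A i j.

End Multiplication.

Definition index_lists (A : octo_algebra) : seq (seq nat) :=
  match A with
  | Octonions =>
      [:: [:: 1; 2; 4]; [:: 1; 3; 5]; [:: 1; 6; 7]; [:: 2; 3; 6];
          [:: 2; 5; 7]; [:: 3; 4; 7]; [:: 4; 5; 6]]
  | SplitOctonions =>
      [:: [:: 1; 2; 3]; [:: 1; 4; 5]; [:: 1; 6; 7]; [:: 2; 4; 6];
          [:: 2; 5; 7]; [:: 3; 4; 7]; [:: 3; 5; 6]]
  end%N.

(* The index sets are numbered from 0 to 6 instead of from 1 to 7. *)
Definition K (A : octo_algebra) (s : 'I_7) : {set 'I_8} :=
  [set i : 'I_8 | val i \in nth [::] (index_lists A) s].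

Section Lattice.
Variables (R : realType) (h : R).

(* The lattice point mh.  A function on the lattice is represented by a function
   on R^8 of which only the values at lattice points are ever used. *)
Definition lattice_pt (m : 'rV[int]_8) : 'rV[R]_8 :=
  h *: map_mx (fun z : int => z%:~R) m.

Definition fdiff (V : lmodType R) (j : 'I_8) (u : 'rV[R]_8 -> V)
    (x : 'rV[R]_8) : V :=
  h^-1 *: (u (x + h *: e j) - u x).

Definition bdiff (V : lmodType R) (j : 'I_8) (u : 'rV[R]_8 -> V)
    (x : 'rV[R]_8) : V :=
  h^-1 *: (u x - u (x - h *: e j)).

(* g D_h^+ : the forward operator acting from the right. *)
Definition rightD_fwd (A : octo_algebra) (g : 'rV[R]_8 -> 'rV[R]_8)
    (x : 'rV[R]_8) : 'rV[R]_8 :=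
  \sum_(j < 8) omul A (fdiff j g x) (e j).

(* D_h^- f : the backward operator acting from the left. *)
Definition leftD_bwd (A : octo_algebra) (f : 'rV[R]_8 -> 'rV[R]_8)
    (x : 'rV[R]_8) : 'rV[R]_8 :=
  \sum_(j < 8) omul A (e j) (bdiff j f x).

End Lattice.

(* R^o is R seen as a module over itself, so that fdiff and bdiff apply. *)
Definition component {R : realType} (f : 'rV[R]_8 -> 'rV[R]_8) (k : 'I_8)
    (x : 'rV[R]_8) : R^o := f x 0 k.

Definition series_converge {R : realType} (h : R)
    (f g : 'rV[R]_8 -> 'rV[R]_8) : Prop :=
  forall i j k : 'I_8,
    esum.summable [set: 'rV[int]_8] (fun m =>
      (fdiff h j (component g i) (lattice_pt h m)
       * component f k (lattice_pt h m) : R)%:E) /\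
    esum.summable [set: 'rV[int]_8] (fun m =>
      (component g i (lattice_pt h m)
       * bdiff h j (component f k) (lattice_pt h m) : R)%:E).

(* Main.v *)
Require Import Defs.
From mathcomp Require Import all_boot all_order all_algebra finmap.
From mathcomp Require Import all_classical all_reals all_analysis.
From mathcomp Require Import lra ring zify.
From mathcomp.analysis.showcase Require summability.
Import Order.TTheory GRing.Theory Num.Theory.
Import numFieldNormedType.Exports.
Local Open Scope ring_scope.
Set Implicit Arguments.
Unset Strict Implicit.

(** Write b(i,j,k) for the sum over the lattice of g_i times the backward
difference of f_k in direction j, and a(i,j,k) for the sum of the forward
difference of g_i in direction j times f_k.  Expanding the products in the
basis, the left-hand side of the formula is h^8 times the sum over i, j, k of
a(i,j,k) (e_i e_j) e_k + b(i,j,k) e_i (e_j e_k).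

Analytic half: a(i,j,k) = - b(i,j,k).  The two summands add up to a difference
w(m + e_j) - w(m), with w(m) = g_i(m) f_k(m - e_j) up to the factor 1/h, so the
matter is whether such a telescoping series sums to 0.  In dimension one it need
not, because w may have different limits at the two ends of the line.
In dimension at least two it does, as soon as the differences of w in a second
direction k' are summable too: the two ends of a line in direction j are
joined by a detour through direction k' that runs far away from any given finite
set, so the variation of w along the detour is as small as one likes, and the
two ends have the same limit.  This is sum_difference_eq0, and
summation_by_parts draws the consequence; convergence of all the series, for
all directions at once, provides the second direction.

Algebraic half: what remains is b(i,j,k) times the associator
e_i (e_j e_k) - (e_i e_j) e_k.  Two distinct imaginary units e_i, e_j lie on
exactly one of the seven lines, and together with the unit 1 that line spans an
associative (quaternion or split-quaternion) algebra; a unit e_k off the line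
anti-associates with them, so that the associator is twice e_i (e_j e_k).  In
all other cases it vanishes.  Hence only the triples on the right-hand side
survive, with the factor 2 (basis_associator, sum_off_line). *)

(** * Unordered sums *)

#[local] Existing Instance summability.totally_filter.

(** Convergence of the net of finite partial sums: unlike the limit that
summability.sum picks, which is a default value on divergent families, this
relation is stable under the operations below. *)
Definition has_sum (I : choiceType) (R : realType) (V : normedModType R)
    (x : I -> V) (l : V) : Prop :=
  (summability.partial_sum x @ summability.totally --> l)%classic.

Lemma partial_sumE (I : choiceType) (V : zmodType) (x : I -> V) (A : {fset I}) :
  summability.partial_sum x A = \sum_(i <- A) x i.
Proof. by rewrite /summability.partial_sum big_seq_fsetE. Qed.

Section HasSum.
Variables (I : choiceType) (R : realType) (V : normedModType R).
Implicit Types (x y : I -> V) (l : V).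

Lemma sum_has_sum x l : has_sum x l -> summability.sum x = l.
Proof. exact: (cvg_lim (@norm_hausdorff _ _)). Qed.

Lemma has_sumP x l : has_sum x l <->
  forall eps : R, 0 < eps -> exists F : {fset I}, forall G : {fset I},
    (F `<=` G)%fset -> `|l - \sum_(i <- G) x i| < eps.
Proof.
split=> [/cvgrPdist_lt xl eps /xl[F _ FP]|H].
  by exists F => G /FP; rewrite /= partial_sumE.
apply/cvgrPdist_lt => eps /H[F FP]; exists F => // G /FP.
by rewrite /= partial_sumE.
Qed.

Lemma eq_has_sum x y l : x =1 y -> has_sum x l -> has_sum y l.
Proof. by move/funext->. Qed.

Lemma has_sum0 : has_sum (fun _ : I => 0 : V) 0.
Proof.
by apply/has_sumP => eps e0; exists fset0 => G _; rewrite big1// subr0 normr0.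
Qed.

Lemma has_sumD x y l l' : has_sum x l -> has_sum y l' ->
  has_sum (fun i => x i + y i) (l + l').
Proof.
move=> xl yl; rewrite /has_sum.
under [summability.partial_sum _]funext => A
  do rewrite partial_sumE big_split/= -!partial_sumE.
exact: cvgD.
Qed.

Lemma has_sum_sum (J : Type) (r : seq J) (P : pred J) (x : J -> I -> V)
    (l : J -> V) :
  (forall j, has_sum (x j) (l j)) ->
  has_sum (fun i => \sum_(j <- r | P j) x j i) (\sum_(j <- r | P j) l j).
Proof.
move=> xl; elim: r => [|j r IH].
  by rewrite big_nil; under eq_fun do rewrite big_nil; exact: has_sum0.
rewrite big_cons; under eq_fun do rewrite big_cons.
by case: (P j) => //; exact: has_sumD.
Qed.

Lemma has_sumZl (x : I -> R) (l : R) (v : V) :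
  has_sum (x : I -> R^o) l -> has_sum (fun i => x i *: v) (l *: v).
Proof.
move=> xl; rewrite /has_sum.
under [summability.partial_sum _]funext => A
  do rewrite partial_sumE -scaler_suml -partial_sumE.
exact: cvgZr_tmp.
Qed.

Lemma has_sumZr (c : R) x l : has_sum x l ->
  has_sum (fun i => c *: x i) (c *: l).
Proof.
move=> xl; rewrite /has_sum.
under [summability.partial_sum _]funext => A
  do rewrite partial_sumE -scaler_sumr -partial_sumE.
exact: cvgZl_tmp.
Qed.

End HasSum.

(** * Absolutely summable families of reals *)

Local Notation abs_summable x :=
  (esum.summable [set: _]%classic (fun z => (x z)%:E)).

Definition tail_bound (I : choiceType) (R : realType) (x : I -> R)
    (F : {fset I}) (eps : R) : Prop :=
  forall G : {fset I}, [disjoint F & G]%fset -> \sum_(i <- G) `|x i| < eps.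

Lemma big_fsetU_disjoint (T : Type) (idx : T) (op : Monoid.com_law idx)
    (I : choiceType) (A B : {fset I}) (F : I -> T) : [disjoint A & B]%fset ->
  \big[op/idx]_(i <- (A `|` B)%fset) F i =
  op (\big[op/idx]_(i <- A) F i) (\big[op/idx]_(i <- B) F i).
Proof.
move=> dAB; rewrite -big_cat; apply: perm_big; apply: uniq_perm => [||i].
- exact: fset_uniq.
- rewrite cat_uniq !fset_uniq andbT/=; apply/hasPn => i iB.
  by apply: contraL iB; exact: fdisjointP.
- by rewrite mem_cat in_fsetU.
Qed.

Section AbsolutelySummable.
Variables (I : choiceType) (R : realType).
Implicit Types x y : I -> R.

Lemma eq_summable x y : x =1 y -> abs_summable x -> abs_summable y.
Proof. by move/funext->. Qed.

(** A finite set whose absolute partial sum is within eps of the supremum leaves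
room for less than eps outside of it. *)
Lemma summable_tail x : abs_summable x -> forall eps : R, 0 < eps ->
  exists F : {fset I}, tail_bound x F eps.
Proof.
move=> xs eps e0; have := xs; rewrite summableE => sfin.
have [_ [A [Afin _] <-]] := ub_ereal_sup_adherent e0 sfin.
rewrite -/(esum _ _) fsbig_finite//= => FP; exists (fset_set A) => G dAG.
have : (\sum_(i <- (fset_set A `|` G)%fset) `|(x i)%:E| <=
        \esum_(i in [set: I]%classic) `|(x i)%:E|)%E.
  apply: ereal_sup_ubound; exists [set` (fset_set A `|` G)%fset]%classic.
    by split.
  by rewrite fsbig_finite//= set_fsetK.
rewrite big_fsetU_disjoint//; move: FP sfin; rewrite /= !sumEFin.
case: (esum _ _) => // s.
by rewrite -EFinD -EFinD lee_fin lte_fin => FP _ GP; lra.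
Qed.

(** Beyond a set that bounds the tail by eps the partial sums move by less than
eps, so that they form a Cauchy net. *)
Lemma summable_has_sum x : abs_summable x ->
  exists l, has_sum (x : I -> R^o) l.
Proof.
move=> xs; exists (summability.sum (x : I -> R^o)); rewrite /has_sum.
apply: (@cauchy_cvg R^o); apply: cauchy_exP => eps e0.
have [F FP] := summable_tail xs e0.
exists (summability.partial_sum x F), F => // G /= FG.
have dFG : [disjoint F & G `\` F]%fset.
  by apply/fdisjointP => i iF; rewrite in_fsetD iF.
rewrite -ball_normE/= !partial_sumE -{1}(fsetID F G) (fsetIidPr FG).
rewrite big_fsetU_disjoint//= opprD addNKr normrN.
by apply: le_lt_trans (FP _ dFG); exact: ler_norm_sum.
Qed.

Lemma summable_comp_bij x (s s' : I -> I) : cancel s s' -> cancel s' s ->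
  abs_summable x -> abs_summable (fun i => x (s i)).
Proof.
move=> sK s'K; rewrite /esum.summable.
rewrite (reindex_esum [set: I]%classic [set: I]%classic s)//; split=> //.
- exact: in2W (can_inj sK).
- by move=> i _; exists (s' i).
Qed.

End AbsolutelySummable.

(** * Telescoping series on the integer lattice *)

Definition unit_vec n (i : 'I_n) : 'rV[int]_n := delta_mx 0 i.

Lemma unit_vecE n (i j : 'I_n) N m :
  (m + unit_vec i *+ N) 0 j = m 0 j + (if j == i then N%:Z else 0).
Proof.
by rewrite mxE mulmxnE mxE eqxx /=; case: eqP => _; rewrite ?natz ?mul0rn.
Qed.

Section Lattice.
Variables (R : realType) (n : nat).
Implicit Types (p u v : 'rV[int]_n -> R) (i j k : 'I_n).

Lemma summable_shift p (a : 'rV[int]_n) :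
  abs_summable p -> abs_summable (fun m => p (m + a)).
Proof. by move/(summable_comp_bij (addrK a) (subrK a)). Qed.

Lemma telescope_line p i (m : 'rV[int]_n) (N : nat) :
  \sum_(s <- iota 0 N)
    (p (m + unit_vec i *+ s + unit_vec i) - p (m + unit_vec i *+ s)) =
  p (m + unit_vec i *+ N) - p m.
Proof.
pose q s := p (m + unit_vec i *+ s).
have -> : p (m + unit_vec i *+ N) - p m = q N - q 0%N.
  by rewrite /q mulr0n addr0.
rewrite -telescope_sumr// /index_iota subn0; apply: eq_bigr => s _.
by rewrite /q mulrSr addrA.
Qed.

Lemma line_variation p i (F : {fset 'rV[int]_n}) (eps : R)
    (m : 'rV[int]_n) (N : nat) :
  tail_bound (fun a => p (a + unit_vec i) - p a) F eps ->
  (forall s, (s < N)%N -> m + unit_vec i *+ s \notin F) ->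
  `|p (m + unit_vec i *+ N) - p m| < eps.
Proof.
move=> tailF avoidF; rewrite -telescope_line.
pose G := [fset (m + unit_vec i *+ s)%R | s in iota 0 N]%fset.
have dFG : [disjoint F & G]%fset.
  rewrite fdisjoint_sym; apply/fdisjointP => _ /imfsetP[s /= + ->].
  by rewrite mem_iota => /avoidF.
apply: le_lt_trans (ler_norm_sum _ _ _) _; apply: le_lt_trans (tailF _ dFG).
rewrite big_imfset/=; last first.
  move=> s t _ _ /(congr1 (fun a : 'rV_n => a 0 i)).
  by rewrite !unit_vecE eqxx => /addrI[].
by rewrite undup_id ?iota_uniq.
Qed.

Lemma fset_bounded (F : {fset 'rV[int]_n}) :
  exists B : nat, forall m : 'rV[int]_n, m \in F -> forall i, `|m 0 i| <= B%:Z.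
Proof.
exists (\sum_(m <- F) \sum_i `|m ord0 i|%N)%N => m mF i.
rewrite -abszE lez_nat (big_fsetD1 m)//= (bigD1 i)//= -addnA; exact: leq_addr.
Qed.

(** The two ends of the segment of half-length T through a, in direction j, are
joined by the other three sides of a rectangle: a side of length T in direction
k, the parallel segment, and a side back.  Since T exceeds 2B, each of these
sides has a coordinate that is larger than B in absolute value throughout, hence
avoids F and F'; each side contributes less than eps. *)
Lemma segment_ends_close p j k (F F' : {fset 'rV[int]_n}) (B : nat) (eps : R)
    (a : 'rV[int]_n) (T : nat) :
  (2 * B < T)%N -> j != k ->
  (forall m, m \in F -> forall i, `|m 0 i| <= B%:Z) ->
  (forall m, m \in F' -> forall i, `|m 0 i| <= B%:Z) ->
  tail_bound (fun m => p (m + unit_vec j) - p m) F eps ->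
  tail_bound (fun m => p (m + unit_vec k) - p m) F' eps ->
  (forall i, `|a 0 i| <= B%:Z) ->
  `|p (a - unit_vec j *+ T + unit_vec j *+ (T + T)) - p (a - unit_vec j *+ T)|
    < eps * 3.
Proof.
move=> BT jk boundF boundF' tailF tailF' bounda.
set b := a - unit_vec j *+ T; set c := b + unit_vec j *+ (T + T).
have bE i : b 0 i = a 0 i - (if i == j then T%:Z else 0).
  by rewrite -[a](subrK (unit_vec j *+ T)) -/b unit_vecE addrK.
have up : `|p (b + unit_vec k *+ T) - p b| < eps.
  apply: line_variation tailF' _ => s sT; apply/negP => /boundF'/(_ j).
  rewrite unit_vecE bE eqxx (negPf jk); have := bounda j; lia.
have down : `|p (c + unit_vec k *+ T) - p c| < eps.
  apply: line_variation tailF' _ => s sT; apply/negP => /boundF'/(_ j).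
  rewrite !unit_vecE bE eqxx (negPf jk); have := bounda j; lia.
have across : `|p (c + unit_vec k *+ T) - p (b + unit_vec k *+ T)| < eps.
  rewrite /c addrAC; apply: line_variation tailF _ => s sT.
  apply/negP => /boundF/(_ k).
  rewrite !unit_vecE bE eqxx eq_sym (negPf jk); have := bounda k; lia.
move: up down across; move: (p _) (p _) (p b) (p c) => p1 p2 p3 p4.
rewrite !ltr_norml; lra.
Qed.

(** Beyond a finite set F the partial sums are within eps of the limit l.  Let G
be the union of the long segments in direction j that meet F: it contains F, and
on each segment the sum telescopes to the difference between its two ends.  The
number of these segments is fixed before their length, so the total of the
differences can be made small as well. *)
Lemma sum_difference_eq0 p j k : j != k ->
  abs_summable (fun m => p (m + unit_vec j) - p m) ->
  abs_summable (fun m => p (m + unit_vec k) - p m) ->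
  has_sum (fun m => (p (m + unit_vec j) - p m : R^o)) 0.
Proof.
move=> jk pj pk; have [l dl] := summable_has_sum pj.
suff l0 : l = 0 by rewrite l0 in dl.
have small eps : 0 < eps -> `|l| < eps * 4.
  move=> e0; have [F FP] := (has_sumP _ _).1 dl _ e0.
  (* The points at height 0 in direction j of the lines that meet F. *)
  pose A : {fset 'rV[int]_n} :=
    [fset (m - unit_vec j *~ m 0 j)%R | m : 'rV[int]_n in F]%fset.
  have A0 a : a \in A -> a 0 j = 0.
    case/imfsetP => m _ ->.
    by rewrite !mxE -scaler_int !mxE intz !eqxx mulr1 subrr.
  have ePos : 0 < eps / (size A).+1%:R by rewrite divr_gt0.
  have [F1 tail1] := summable_tail pj ePos.
  have [F2 tail2] := summable_tail pk ePos.
  have [B BP] := fset_bounded (F `|` A `|` F1 `|` F2)%fset.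
  pose T := (2 * B).+1; have : (2 * B < T)%N by []; clearbody T => BT.
  pose G := [fset (a - unit_vec j *+ T + unit_vec j *+ s)%R
    | a : 'rV[int]_n in A, s : nat in iota 0 (T + T)]%fset.
  have FG : (F `<=` G)%fset.
    apply/fsubsetP => m mF; have := BP m; rewrite !in_fsetU mF => /(_ isT j) mB.
    apply/imfset2P; exists (m - unit_vec j *~ m 0 j).
      by apply/imfsetP; exists m.
    have steps (z : int) : `|z| <= B%:Z ->
        absz (z + T%:Z) \in iota 0 (T + T) /\ 0 <= z + T%:Z.
      by rewrite mem_iota; lia.
    have [? /gez0_abs sE] := steps _ mB.
    exists (absz (m 0 j + T%:Z)) => //; rewrite (pmulrn _ (absz _)) sE.
    by rewrite mulrzDr -pmulrn -[m - _ - _]addrA -opprD subrK.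
  have Gsum : \sum_(m <- G) (p (m + unit_vec j) - p m) =
      \sum_(a <- A) (p (a - unit_vec j *+ T + unit_vec j *+ (T + T)) -
                     p (a - unit_vec j *+ T)).
    rewrite big_imfset2/=; last first.
      move=> [a s] [a' s'] /andP[/= aA _] /andP[/= a'A _] eq_as.
      have ss' : s = s'.
        have := congr1 (fun m : 'rV[int]_n => m 0 j) eq_as.
        rewrite !unit_vecE eqxx [X in X + _]mxE [X in _ = X + _]mxE.
        rewrite (A0 a)// (A0 a')//.
        by move/addrI => -[].
      by move: eq_as; rewrite ss' => /addIr/addIr ->.
    by apply: eq_bigr => a _; rewrite undup_id ?iota_uniq// telescope_line.
  have := FP _ FG; rewrite Gsum.
  have : `|\sum_(a <- A) (p (a - unit_vec j *+ T + unit_vec j *+ (T + T)) -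
                     p (a - unit_vec j *+ T))| <= eps * 3.
    apply: le_trans (ler_norm_sum _ _ _) _.
    apply: (@le_trans _ _ (\sum_(a <- A) eps / (size A).+1%:R * 3)).
      rewrite big_seq [leRHS]big_seq; apply: ler_sum => a aA.
      apply: ltW; apply: (segment_ends_close BT jk _ _ tail1 tail2);
        [move=> m mF | move=> m mF |];
        by apply: BP; rewrite !in_fsetU ?aA ?mF ?orbT.
    rewrite big_const_seq count_predT iter_addr_0 -[leLHS]mulr_natr.
    rewrite mulrAC ler_wpM2r// mulrAC ler_pdivrMr// ler_wpM2l ?(ltW e0)//.
    by rewrite ler_nat.
  rewrite !ler_norml !ltr_norml; lra.
apply/eqP; rewrite -normr_le0; apply/ler_addgt0Pl => eps e0.
have e4 : 0 < eps / 4 by lra.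
by have := small _ e4; lra.
Qed.

(** The products add up to w(m + e_j) - w(m) for w(m) = u(m) v(m - e_j).  The
difference of w in the other direction k is also a combination of the given
summable families and of their translates, as sum_difference_eq0 requires. *)
Lemma summation_by_parts u v j k : j != k ->
  (forall i, abs_summable (fun m => (u (m + unit_vec i) - u m) * v m)) ->
  (forall i, abs_summable (fun m => u m * (v m - v (m - unit_vec i)))) ->
  exists b : R,
    has_sum (fun m => ((u (m + unit_vec j) - u m) * v m : R^o)) (- b) /\
    has_sum (fun m => (u m * (v m - v (m - unit_vec j)) : R^o)) b.
Proof.
move=> jk fw bw.
have [a ua] := summable_has_sum (fw j); have [b vb] := summable_has_sum (bw j).
exists b; split=> //.
pose w m := u m * v (m - unit_vec j).
have wj : w \o +%R^~ (unit_vec j) \- w =1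
    (fun m => (u (m + unit_vec j) - u m) * v m +
              u m * (v m - v (m - unit_vec j))).
  by move=> m; rewrite /= /w addrK; ring.
have wk : w \o +%R^~ (unit_vec k) \- w =1
    (fun m => ((u (m + unit_vec k) - u m) * v m
      + u (m + unit_vec k)
        * (v (m + unit_vec k) - v (m + unit_vec k - unit_vec k)))
      - (u (m + unit_vec k)
         * (v (m + unit_vec k) - v (m + unit_vec k - unit_vec j))
      - u m * (v m - v (m - unit_vec j)))).
  by move=> m; rewrite /= /w addrK; ring.
have wj_summable : abs_summable (fun m => w (m + unit_vec j) - w m).
  by apply: eq_summable (fsym wj) _; exact: summableD (fw j) (bw j).
have wk_summable : abs_summable (fun m => w (m + unit_vec k) - w m).
  have up_k := summable_shift (unit_vec k) (bw k).
  have up_j := summable_shift (unit_vec k) (bw j).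
  apply: eq_summable (fsym wk) _.
  exact: (summableB (summableD (fw k) up_k) (summableB up_j (bw j))).
have := sum_difference_eq0 jk wj_summable wk_summable.
move=> /(eq_has_sum wj)/sum_has_sum s0.
suff -> : - b = a by [].
by have := sum_has_sum (has_sumD ua vb); rewrite s0 => /eqP;
  rewrite eq_sym addr_eq0 => /eqP ->.
Qed.

End Lattice.

(** * Associators of basis elements *)

Section Bilinearity.
Variables (R : realType) (A : octo_algebra).
Implicit Types x y : 'rV[R]_8.

Lemma omulDl x x' y : omul A (x + x') y = omul A x y + omul A x' y.
Proof.
rewrite /omul -big_split; apply: eq_bigr => i _ /=.
by rewrite -big_split; apply: eq_bigr => j _ /=; rewrite mxE mulrDl scalerDl.
Qed.

Lemma omulDr x y y' : omul A x (y + y') = omul A x y + omul A x y'.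
Proof.
rewrite /omul -big_split; apply: eq_bigr => i _ /=.
by rewrite -big_split; apply: eq_bigr => j _ /=; rewrite mxE mulrDr scalerDl.
Qed.

Lemma omulZl c x y : omul A (c *: x) y = c *: omul A x y.
Proof.
rewrite /omul scaler_sumr; apply: eq_bigr => i _ /=.
rewrite scaler_sumr; apply: eq_bigr => j _ /=.
by rewrite mxE scalerA mulrA.
Qed.

Lemma omulZr c x y : omul A x (c *: y) = c *: omul A x y.
Proof.
rewrite /omul scaler_sumr; apply: eq_bigr => i _ /=.
rewrite scaler_sumr; apply: eq_bigr => j _ /=.
by rewrite mxE scalerA mulrCA.
Qed.

Lemma omul_suml (J : Type) (r : seq J) (P : pred J) (F : J -> 'rV[R]_8) y :
  omul A (\sum_(j <- r | P j) F j) y = \sum_(j <- r | P j) omul A (F j) y.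
Proof.
apply: (big_morph (fun x => omul A x y)) => [u v|]; first exact: omulDl.
by have := omulZl 0 0 y; rewrite !scale0r.
Qed.

Lemma omul_sumr (J : Type) (r : seq J) (P : pred J) (F : J -> 'rV[R]_8) x :
  omul A x (\sum_(j <- r | P j) F j) = \sum_(j <- r | P j) omul A x (F j).
Proof.
apply: (big_morph (omul A x)) => [u v|]; first exact: omulDr.
by have := omulZr 0 x 0; rewrite !scale0r.
Qed.

Lemma omul_expandl x y : omul A x y = \sum_(i < 8) x 0 i *: omul A (e i) y.
Proof.
rewrite [x in LHS]row_sum_delta omul_suml.
by apply: eq_bigr => i _; rewrite omulZl.
Qed.

Lemma omul_expandr x y : omul A x y = \sum_(j < 8) y 0 j *: omul A x (e j).
Proof.
rewrite [y in LHS]row_sum_delta omul_sumr.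
by apply: eq_bigr => j _; rewrite omulZr.
Qed.

Lemma omul_basis i j : omul A (e i) (e j) = basis_mul R A i j.
Proof.
rewrite /omul (bigD1 i)//= (bigD1 j)//= !mxE !eqxx mul1r scale1r.
rewrite big1 => [|k kj]; last by rewrite !mxE eqxx (negPf kj) mulr0 scale0r.
rewrite addr0 big1 ?addr0// => k ki; rewrite big1// => l _.
by rewrite !mxE eqxx (negPf ki) mul0r scale0r.
Qed.

End Bilinearity.

(** Products of basis elements are plus or minus basis elements.  Recording the
sign (true for minus) and the index as data that compute turns the 512 products
of three basis elements into a finite check. *)
Definition product_table (A : octo_algebra) : seq (seq (bool * nat)) :=
  let p k := (false, k) in let n k := (true, k) in
  match A with
  | Octonions =>
      [:: [:: p 0; p 1; p 2; p 3; p 4; p 5; p 6; p 7];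
          [:: p 1; n 0; p 4; p 5; n 2; n 3; n 7; p 6];
          [:: p 2; n 4; n 0; p 6; p 1; p 7; n 3; n 5];
          [:: p 3; n 5; n 6; n 0; n 7; p 1; p 2; p 4];
          [:: p 4; p 2; n 1; p 7; n 0; n 6; p 5; n 3];
          [:: p 5; p 3; n 7; n 1; p 6; n 0; n 4; p 2];
          [:: p 6; p 7; p 3; n 2; n 5; p 4; n 0; n 1];
          [:: p 7; n 6; p 5; n 4; p 3; n 2; p 1; n 0]]
  | SplitOctonions =>
      [:: [:: p 0; p 1; p 2; p 3; p 4; p 5; p 6; p 7];
          [:: p 1; n 0; p 3; n 2; n 5; p 4; n 7; p 6];
          [:: p 2; n 3; n 0; p 1; n 6; p 7; p 4; n 5];
          [:: p 3; p 2; n 1; n 0; n 7; n 6; p 5; p 4];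
          [:: p 4; p 5; p 6; p 7; p 0; p 1; p 2; p 3];
          [:: p 5; n 4; n 7; p 6; n 1; p 0; p 3; n 2];
          [:: p 6; p 7; n 4; n 5; n 2; n 3; p 0; p 1];
          [:: p 7; n 6; p 5; n 4; n 3; p 2; n 1; p 0]]
  end%N.

Definition table_mul (A : octo_algebra) (x y : bool * nat) : bool * nat :=
  let z := nth (false, 0%N) (nth [::] (product_table A) x.2) y.2 in
  (x.1 (+) y.1 (+) z.1, z.2).

Definition signed_basis {R : realType} (x : bool * nat) : 'rV[R]_8 :=
  (-1) ^+ x.1 *: e (inord x.2).

Arguments table_mul : simpl never.

Lemma signed_basis_mul (R : realType) A (x y : bool * nat) :
  (x.2 < 8)%N -> (y.2 < 8)%N ->
  omul A (signed_basis x) (signed_basis y) =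
  signed_basis (table_mul A x y) :> 'rV[R]_8.
Proof.
case: x y => b i [c j] /= i8 j8.
rewrite /signed_basis /= omulZl omulZr scalerA omul_basis.
rewrite /table_mul /= 2!signr_addb -[in RHS]scalerA; congr (_ *: _).
clear b c.
rewrite -(inordK i8) -(inordK j8); move: (inord i) (inord j) => {}i {}j {i8 j8}.
rewrite !inord_val.
case: A; case: i => [[|[|[|[|[|[|[|[|//]]]]]]]] i8];
  case: j => [[|[|[|[|[|[|[|[|//]]]]]]]] j8];
  rewrite /basis_mul /= ?opprK ?expr0 ?expr1 ?scaleN1r ?scale1r //;
  try (congr e; apply: val_inj; rewrite /= inordK //).
Qed.

Definition off_line (i j k : nat) (l : seq nat) : bool :=
  [&& i \in l, j \in l, j != i, (1 <= k)%N & k \notin l].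

Lemma table_mul_lt A x y : (x.2 < 8)%N -> (y.2 < 8)%N ->
  ((table_mul A x y).2 < 8)%N.
Proof.
case: x y => b i [c j] /= i8 j8; rewrite /table_mul /=.
have /allP/(_ i) : all (fun i => all (fun j =>
    (nth (false, 0) (nth [::] (product_table A) i) j).2 < 8)%N
  (iota 0 8)) (iota 0 8) by case: A; vm_compute.
by rewrite mem_iota => /(_ i8)/allP/(_ j); rewrite mem_iota => /(_ j8).
Qed.

(** By inspection of the tables: at most one line contains i and j but not k; if
there is one, the two ways of bracketing differ by the sign, and otherwise they
agree. *)
Lemma table_associator A i j k : (i < 8)%N -> (j < 8)%N -> (k < 8)%N ->
  let l := table_mul A (false, i) (table_mul A (false, j) (false, k)) in
  (count (off_line i j k) (index_lists A),
   table_mul A (table_mul A (false, i) (false, j)) (false, k)) \in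
  [:: (0%N, l); (1%N, (~~ l.1, l.2))].
Proof.
move=> i8 j8 k8.
have /allP/(_ i) : all (fun i => all (fun j => all (fun k =>
    let l := table_mul A (false, i) (table_mul A (false, j) (false, k)) in
    (count (off_line i j k) (index_lists A),
     table_mul A (table_mul A (false, i) (false, j)) (false, k)) \in
    [:: (0%N, l); (1%N, (~~ l.1, l.2))])
  (iota 0 8)) (iota 0 8)) (iota 0 8) by case: A; vm_compute.
rewrite mem_iota => /(_ i8)/allP/(_ j).
rewrite mem_iota => /(_ j8)/allP/(_ k).
by rewrite mem_iota => /(_ k8).
Qed.

Lemma basis_associator (R : realType) A (i j k : 'I_8) :
  omul A (e i) (omul A (e j) (e k)) - omul A (omul A (e i) (e j)) (e k) =
  (omul A (e i) (omul A (e j) (e k)) *+ 2)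
    *+ count (off_line i j k) (index_lists A) :> 'rV[R]_8.
Proof.
have eE (l : 'I_8) : e l = signed_basis (false, val l) :> 'rV[R]_8.
  by rewrite /signed_basis /= inord_val scale1r.
rewrite !eE !signed_basis_mul ?table_mul_lt ?ltn_ord//.
have := table_associator A (ltn_ord i) (ltn_ord j) (ltn_ord k); cbv zeta.
move: (table_mul A (false, i : nat) (table_mul _ _ _)) => l.
move: (table_mul A (table_mul _ _ _) _) => r.
rewrite !inE => /orP[] /eqP[-> ->]; first by rewrite subrr mulr0n.
rewrite mulr1n mulr2n; congr (_ + _).
by rewrite /signed_basis /= signrN scaleNr opprK.
Qed.

Lemma sum_off_line (V : nmodType) A (G : 'I_8 -> 'I_8 -> 'I_8 -> V) :
  \sum_(s < 7) \sum_(i in K A s) \sum_(j in K A s | j != i)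
    \sum_(k < 8 | (1 <= k)%N && (k \notin K A s)) G i j k =
  \sum_(i < 8) \sum_(j < 8) \sum_(k < 8)
    G i j k *+ count (off_line i j k) (index_lists A).
Proof.
transitivity (\sum_(s < 7) \sum_(i < 8) \sum_(j < 8) \sum_(k < 8)
    if off_line i j k (nth [::] (index_lists A) s) then G i j k else 0).
  apply: eq_bigr => s _; rewrite big_mkcond; apply: eq_bigr => i _.
  rewrite /off_line inE; case: ifP => _ /=; last first.
    by rewrite big1// => j _; rewrite big1.
  rewrite big_mkcond; apply: eq_bigr => j _; rewrite inE.
  case: (val j \in _) => /=; last by rewrite big1.
  rewrite -(inj_eq val_inj); case: (_ != _) => /=; last by rewrite big1.
  by rewrite big_mkcond; apply: eq_bigr => k _; rewrite inE.
rewrite exchange_big; apply: eq_bigr => i _.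
rewrite exchange_big; apply: eq_bigr => j _.
rewrite exchange_big; apply: eq_bigr => k _.
rewrite -iter_addr_0 -big_const_seq [RHS]big_mkcond (big_nth [::]) big_mkord.
by case: A.
Qed.

(** * Stokes' formula *)

Lemma lattice_pt_shift (R : realType) (h : R) (m : 'rV[int]_8) (j : 'I_8) :
  lattice_pt h (m + unit_vec j) = lattice_pt h m + h *: e j.
Proof.
rewrite /lattice_pt -scalerDr; congr (_ *: _).
by apply/rowP => i; rewrite !mxE rmorphD /= rmorph_nat.
Qed.

Lemma lattice_pt_shiftN (R : realType) (h : R) (m : 'rV[int]_8) (j : 'I_8) :
  lattice_pt h (m - unit_vec j) = lattice_pt h m - h *: e j.
Proof.
by apply/eqP; rewrite eq_sym subr_eq -lattice_pt_shift subrK.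
Qed.

Lemma lattice_summation_by_parts (R : realType) (h : R)
    (f g : 'rV[R]_8 -> 'rV[R]_8) : series_converge h f g ->
  forall i j k : 'I_8, exists b : R,
    has_sum (fun m => (fdiff h j (component g i) (lattice_pt h m)
                       * component f k (lattice_pt h m) : R^o)) (- b) /\
    has_sum (fun m => (component g i (lattice_pt h m)
                       * bdiff h j (component f k) (lattice_pt h m) : R^o)) b.
Proof.
move=> conv i j k.
(* The factor 1/h of both difference quotients is moved to g_i. *)
pose u m := h^-1 * (component g i (lattice_pt h m) : R).
pose v m := component f k (lattice_pt h m) : R.
have fwE j' : (fun m => fdiff h j' (component g i) (lattice_pt h m)
                        * component f k (lattice_pt h m) : R) =1
              (fun m => (u (m + unit_vec j') - u m) * v m).
  by move=> m; rewrite /u /v lattice_pt_shift -mulrBr.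
have bwE j' : (fun m => component g i (lattice_pt h m)
                        * bdiff h j' (component f k) (lattice_pt h m) : R) =1
              (fun m => u m * (v m - v (m - unit_vec j'))).
  by move=> m; rewrite /u /v lattice_pt_shiftN mulrCA mulrA.
have [k' jk'] : exists k' : 'I_8, j != k'.
  by case: (eqVneq j ord0) => [->|]; [exists ord_max | exists ord0].
have [||b [fw bw]] := @summation_by_parts _ _ u v j k' jk'.
- by move=> j'; apply: eq_summable (fwE j') _; have [] := conv i j' k.
- by move=> j'; apply: eq_summable (bwE j') _; have [] := conv i j' k.
exists b; split.
- exact: eq_has_sum (fsym (fwE j)) fw.
- exact: eq_has_sum (fsym (bwE j)) bw.
Qed.

Lemma omul_rightD (R : realType) (h : R) A (f g : 'rV[R]_8 -> 'rV[R]_8) x :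
  omul A (rightD_fwd h A g x) (f x) =
  \sum_(i < 8) \sum_(j < 8) \sum_(k < 8)
    (fdiff h j (component g i) x * component f k x : R)
      *: omul A (omul A (e i) (e j)) (e k).
Proof.
rewrite /rightD_fwd omul_suml [RHS]exchange_big; apply: eq_bigr => j _.
rewrite (omul_expandl _ (fdiff h j g x)) omul_suml; apply: eq_bigr => i _.
rewrite omulZl (omul_expandr _ _ (f x)) scaler_sumr; apply: eq_bigr => k _.
by rewrite scalerA !mxE.
Qed.

Lemma omul_leftD (R : realType) (h : R) A (f g : 'rV[R]_8 -> 'rV[R]_8) x :
  omul A (g x) (leftD_bwd h A f x) =
  \sum_(i < 8) \sum_(j < 8) \sum_(k < 8)
    (component g i x * bdiff h j (component f k) x : R)
      *: omul A (e i) (omul A (e j) (e k)).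
Proof.
rewrite omul_expandl; apply: eq_bigr => i _.
rewrite /leftD_bwd omul_sumr scaler_sumr; apply: eq_bigr => j _.
rewrite (omul_expandr _ _ (bdiff h j f x)) omul_sumr scaler_sumr.
by apply: eq_bigr => k _; rewrite omulZr scalerA !mxE.
Qed.

Theorem theorem1 (R : realType) (h : R) (hpos : 0 < h) (A : octo_algebra)
    (f g : 'rV[R]_8 -> 'rV[R]_8) (hconv : series_converge h f g) :
  summability.sum (fun m : 'rV[int]_8 =>
    h ^+ 8 *: (omul A (rightD_fwd h A g (lattice_pt h m)) (f (lattice_pt h m))
             + omul A (g (lattice_pt h m)) (leftD_bwd h A f (lattice_pt h m))))
  = 2 *: summability.sum (fun m : 'rV[int]_8 =>
      \sum_(s < 7) \sum_(i in K A s) \sum_(j in K A s | j != i)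
        \sum_(k < 8 | (1 <= k)%N && (k \notin K A s))
          h ^+ 8 *: ((component g i (lattice_pt h m)
                      * bdiff h j (component f k) (lattice_pt h m))
                     *: omul A (e i) (omul A (e j) (e k)))).
Proof.
pose b (i j k : 'I_8) : R := summability.sum (fun m =>
  component g i (lattice_pt h m)
  * bdiff h j (component f k) (lattice_pt h m) : R^o).
have parts i j k :
    has_sum (fun m => (fdiff h j (component g i) (lattice_pt h m)
                       * component f k (lattice_pt h m) : R^o)) (- b i j k) /\
    has_sum (fun m => (component g i (lattice_pt h m)
                       * bdiff h j (component f k) (lattice_pt h m) : R^o))
            (b i j k).
  have [b' [fw bw]] := lattice_summation_by_parts hconv i j k.
  by rewrite /b (sum_has_sum bw).
pose T i j k : 'rV[R]_8 := omul A (e i) (omul A (e j) (e k)).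
transitivity (h ^+ 8 *: (
    (\sum_(i < 8) \sum_(j < 8) \sum_(k < 8)
       - b i j k *: omul A (omul A (e i) (e j)) (e k)) +
    (\sum_(i < 8) \sum_(j < 8) \sum_(k < 8) b i j k *: T i j k))).
  apply: sum_has_sum; apply: has_sumZr.
  under eq_fun do rewrite omul_rightD omul_leftD.
  by apply: has_sumD; apply: has_sum_sum => i; apply: has_sum_sum => j;
    apply: has_sum_sum => k; have [fw bw] := parts i j k;
    [exact: has_sumZl _ fw | exact: has_sumZl _ bw].
have -> : summability.sum (fun m : 'rV[int]_8 =>
      \sum_(s < 7) \sum_(i in K A s) \sum_(j in K A s | j != i)
        \sum_(k < 8 | (1 <= k)%N && (k \notin K A s))
          h ^+ 8 *: ((component g i (lattice_pt h m)
                      * bdiff h j (component f k) (lattice_pt h m)) *: T i j k))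
    = \sum_(s < 7) \sum_(i in K A s) \sum_(j in K A s | j != i)
        \sum_(k < 8 | (1 <= k)%N && (k \notin K A s))
          h ^+ 8 *: (b i j k *: T i j k).
  apply: sum_has_sum; apply: has_sum_sum => s.
  apply: has_sum_sum => i; apply: has_sum_sum => j; apply: has_sum_sum => k.
  by have [_ bw] := parts i j k; apply: has_sumZr; exact: has_sumZl _ bw.
rewrite sum_off_line.
do 3!(rewrite -big_split !scaler_sumr; apply: eq_bigr => ? _).
rewrite /= addrC scaleNr -scalerBr basis_associator.
by rewrite -!scalerMnr scaler_nat mulrnAC.
Qed.
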